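(* Assume $\operatorname{char}(\Bbbk)\neq 2$. Let $B$ and $C$ be $\Bbbk$-algebras. Let $M_\bullet:\ \cdots\to M_m\xrightarrow{d_m}M_{m-1}\to\cdots\to M_1\xrightarrow{d_1}M_0\to 0$ be an exact complex of $B$-modules admitting a $B$-homotopy $h_\bullet$, and let $N_\bullet:\ \cdots\to N_n\xrightarrow{\delta_n}N_{n-1}\to\cdots\to N_1\xrightarrow{\delta_1}N_0\to 0$ be an exact complex of $C$-modules admitting a $C$-homotopy $\eta_\bullet$. Then the total complex $\operatorname{Tot}(M_\bullet\otimes N_\bullet)$ admits a $B\otimes C$-homotopy.
   Context: Throughout, $\Bbbk$ is a perfect field and all algebras are Artin algebras over $\Bbbk$; $\otimes=\otimes_\Bbbk$; modules are finitely generated left modules. A complex $(M_n,d_n)$ is said to admit a $B$-homotopy if there are $B$-linear maps $h_n:M_n\to M_{n+1}$ with $d_{n+1}h_n+h_{n-1}d_n=1_{M_n}$ for all indices $n$ (terms in negative degree being zero). The total complex has components $\operatorname{Tot}(M_\bullet\otimes N_\bullet)_s=\bigoplus_{n+m=s}M_n\otimes N_m$ and differential in degree $s$ equal to $\sum_{n+m=s}\bigl(d_n\otimes 1_{N_m}+(-1)^n 1_{M_n}\otimes\delta_m\bigr)$. *)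

(* Defs.v *)
From HB Require Import structures.
From mathcomp Require Import all_boot all_algebra all_field.
From mathcomp Require Import boolp.

Set Implicit Arguments.
Unset Strict Implicit.
Unset Printing Implicit Defensive.

Import GRing.Theory.
Local Open Scope ring_scope.
Local Open Scope quotient_scope.

Definition perfect_field (k : fieldType) : Prop :=
  forall p : {poly k}, irreducible_poly p -> separable_poly p.

Definition fin_gen (A : pzRingType) (V : lmodType A) : Prop :=
  exists (r : nat) (g : 'I_r -> V),
    forall x : V, exists a : 'I_r -> A, x = \sum_i a i *: g i.

(* The tensor product is presented as a commutative monoid: a list of pairs
   stands for the formal sum of the pure tensors of its entries, and [tens_eq]
   is the congruence generated by commutativity and bilinearity.  Opposites
   exist in the quotient because of [tens_eq_addl] and [tens_eq_0].  *)
Inductive tens_eq (k : fieldType) (U V : lmodType k) :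
    seq (U * V) -> seq (U * V) -> Prop :=
| tens_eq_refl s : tens_eq s s
| tens_eq_sym s t : tens_eq s t -> tens_eq t s
| tens_eq_trans s t r : tens_eq s t -> tens_eq t r -> tens_eq s r
| tens_eq_cat s s' t t' :
    tens_eq s s' -> tens_eq t t' -> tens_eq (s ++ t) (s' ++ t')
| tens_eq_catC s t : tens_eq (s ++ t) (t ++ s)
| tens_eq_0 v : tens_eq [:: (0, v)] [::]
| tens_eq_addl u u' v : tens_eq [:: (u + u', v)] [:: (u, v); (u', v)]
| tens_eq_addr u v v' : tens_eq [:: (u, v + v')] [:: (u, v); (u, v')]
| tens_eq_scale (a : k) u v : tens_eq [:: (a *: u, v)] [:: (u, a *: v)].

Section TensorDef.
Variables (k : fieldType) (U V : lmodType k).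

Definition tens_rel : rel (seq (U * V)) := fun s t => `[< tens_eq s t >].

Lemma tens_rel_refl : reflexive tens_rel.
Proof. by move=> s; apply/asboolP/tens_eq_refl. Qed.
Lemma tens_rel_sym : symmetric tens_rel.
Proof.
by move=> s t; apply/idP/idP => /asboolP h; apply/asboolP/tens_eq_sym.
Qed.
Lemma tens_rel_trans : transitive tens_rel.
Proof.
by move=> s t r /asboolP h /asboolP h'; apply/asboolP/(tens_eq_trans h h').
Qed.

Canonical tens_rel_equiv :=
  EquivRel tens_rel tens_rel_refl tens_rel_sym tens_rel_trans.

Definition tens : Type := {eq_quot tens_rel}.
HB.instance Definition _ := Choice.copy tens {eq_quot tens_rel}.

Definition tens_class (s : seq (U * V)) : tens := \pi_({eq_quot tens_rel}) s.
Definition tens_repr (x : tens) : seq (U * V) := repr (x : {eq_quot tens_rel}).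

Lemma tens_reprK x : tens_class (tens_repr x) = x.
Proof. exact: reprK. Qed.

Lemma tens_classP (s t : seq (U * V)) : tens_class s = tens_class t <-> tens_eq s t.
Proof. by split=> [/eqmodP/asboolP //|h]; apply/eqmodP/asboolP. Qed.

Lemma tens_class_repr s : tens_eq (tens_repr (tens_class s)) s.
Proof. by apply/tens_classP; rewrite tens_reprK. Qed.

Definition tens_zero : tens := tens_class [::].
Definition tens_add (x y : tens) : tens :=
  tens_class (tens_repr x ++ tens_repr y).
Definition tens_scale (a : k) (x : tens) : tens :=
  tens_class [seq (a *: p.1, p.2) | p <- tens_repr x].

Lemma tens_addE s t :
  tens_add (tens_class s) (tens_class t) = tens_class (s ++ t).
Proof. by apply/tens_classP/tens_eq_cat; apply: tens_class_repr. Qed.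

Lemma tens_scale_eq a (s t : seq (U * V)) : tens_eq s t ->
  tens_eq [seq (a *: p.1, p.2) | p <- s] [seq (a *: p.1, p.2) | p <- t].
Proof.
elim=> {s t} [s|s t _ h|s t r _ h _ h'|s s' t t' _ h _ h'|s t|v|u u' v
  |u v v'|b u v] /=; rewrite ?map_cat.
- exact: tens_eq_refl.
- exact: tens_eq_sym.
- exact: tens_eq_trans h h'.
- exact: tens_eq_cat.
- exact: tens_eq_catC.
- rewrite scaler0; exact: tens_eq_0.
- rewrite scalerDr; exact: tens_eq_addl.
- exact: tens_eq_addr.
- rewrite scalerA mulrC -scalerA; exact: tens_eq_scale.
Qed.

Lemma tens_scaleE a s :
  tens_scale a (tens_class s) = tens_class [seq (a *: p.1, p.2) | p <- s].
Proof. by apply/tens_classP/tens_scale_eq/tens_class_repr. Qed.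

Lemma tens_addA : associative tens_add.
Proof.
move=> x y z; rewrite -(tens_reprK x) -(tens_reprK y) -(tens_reprK z).
by rewrite !tens_addE catA.
Qed.

Lemma tens_addC : commutative tens_add.
Proof.
move=> x y; rewrite -(tens_reprK x) -(tens_reprK y) !tens_addE.
exact/tens_classP/tens_eq_catC.
Qed.

Lemma tens_add0 : left_id tens_zero tens_add.
Proof. by move=> x; rewrite -(tens_reprK x) tens_addE. Qed.

Lemma tens_addN : left_inverse tens_zero (tens_scale (- 1)) tens_add.
Proof.
move=> x; rewrite -(tens_reprK x) tens_scaleE tens_addE.
apply/tens_classP; elim: (tens_repr x) => [|[u v] s ih] /=.
  exact: tens_eq_refl.
rewrite -cat_cons -[(u, v) :: s]/([:: (u, v)] ++ s) catA.
apply: tens_eq_trans (tens_eq_cat (tens_eq_catC _ _) (tens_eq_refl s)) _.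
rewrite -catA; set r := [seq _ | _ <- s] in ih *.
apply: tens_eq_trans ih; rewrite -[r ++ s]/([::] ++ (r ++ s)).
rewrite -[(_, _) :: r]/([:: (-1 *: u, v)] ++ r) -catA catA.
apply: tens_eq_cat (tens_eq_refl _).
apply: tens_eq_trans (tens_eq_sym (tens_eq_addl _ _ _)) _.
rewrite scaleN1r subrr; exact: tens_eq_0.
Qed.

HB.instance Definition _ :=
  GRing.isZmodule.Build tens tens_addA tens_addC tens_add0 tens_addN.

Definition pure (u : U) (v : V) : tens := tens_class [:: (u, v)].

Lemma pureDl u u' v : pure (u + u') v = pure u v + pure u' v.
Proof. by rewrite /GRing.add /= tens_addE; apply/tens_classP/tens_eq_addl. Qed.

Lemma pureDr u v v' : pure u (v + v') = pure u v + pure u v'.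
Proof. by rewrite /GRing.add /= tens_addE; apply/tens_classP/tens_eq_addr. Qed.

Lemma pure_balanced a u v : pure (a *: u) v = pure u (a *: v).
Proof. exact/tens_classP/tens_eq_scale. Qed.

Lemma tens_classE s : tens_class s = \sum_(p <- s) pure p.1 p.2.
Proof.
elim: s => [|[u v] s ih]; first by rewrite big_nil.
by rewrite big_cons -ih /GRing.add /= tens_addE.
Qed.

Lemma tens_ind (P : tens -> Prop) :
  P 0 -> (forall u v, P (pure u v)) -> (forall x y, P x -> P y -> P (x + y)) ->
  forall x, P x.
Proof.
move=> P0 Pp PD x; rewrite -(tens_reprK x) tens_classE.
exact: (big_ind P).
Qed.

Lemma tens_scale_pure a u v : tens_scale a (pure u v) = pure (a *: u) v.
Proof. by rewrite tens_scaleE. Qed.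

Lemma tens_scaleDr : right_distributive tens_scale +%R.
Proof.
move=> a x y; rewrite -(tens_reprK x) -(tens_reprK y) /GRing.add /=.
by rewrite !(tens_scaleE, tens_addE) map_cat.
Qed.

Lemma tens_scale0r a : tens_scale a 0 = 0.
Proof. by rewrite /GRing.zero /= tens_scaleE. Qed.

Lemma tens_scaleA a b x : tens_scale a (tens_scale b x) = tens_scale (a * b) x.
Proof.
elim/tens_ind: x => [|u v|x y hx hy].
- by rewrite !tens_scale0r.
- by rewrite !tens_scale_pure scalerA.
- by rewrite !tens_scaleDr hx hy.
Qed.

Lemma tens_scale1 : left_id 1 tens_scale.
Proof.
elim/tens_ind => [|u v|x y hx hy].
- by rewrite !tens_scale0r.
- by rewrite tens_scale_pure scale1r.
- by rewrite tens_scaleDr hx hy.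
Qed.

Lemma tens_scaleDl x : {morph tens_scale^~ x : a b / a + b}.
Proof.
move=> a b; elim/tens_ind: x => [|u v|x y hx hy].
- by rewrite !tens_scale0r addr0.
- by rewrite !tens_scale_pure scalerDl pureDl.
- by rewrite !tens_scaleDr hx hy addrACA.
Qed.

HB.instance Definition _ := GRing.Zmodule_isLmodule.Build k tens
  tens_scaleA tens_scale1 tens_scaleDr tens_scaleDl.

Lemma scale_pure (a : k) u v : a *: pure u v = pure (a *: u) v.
Proof. exact: tens_scale_pure. Qed.

Section Lift.
Variables (P : zmodType) (f : U -> V -> P).

Definition balanced : Prop :=
  [/\ forall u u' v, f (u + u') v = f u v + f u' v,
      forall u v v', f u (v + v') = f u v + f u v'
    & forall (a : k) u v, f (a *: u) v = f u (a *: v)].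

Definition tens_lift (x : tens) : P := \sum_(p <- tens_repr x) f p.1 p.2.

Hypothesis fB : balanced.

Lemma tens_lift_class s : tens_lift (tens_class s) = \sum_(p <- s) f p.1 p.2.
Proof.
have [fDl fDr fZ] := fB.
suff eqf (r t : seq (U * V)) : tens_eq r t ->
    \sum_(p <- r) f p.1 p.2 = \sum_(p <- t) f p.1 p.2.
  exact/eqf/tens_class_repr.
elim=> {r t} [r|r t _ ->|r t q _ -> _ ->|r r' t t' _ h _ h'|r t|v|u u' v
  |u v v'|a u v] //.
- by rewrite !big_cat /= h h'.
- by rewrite !big_cat /= addrC.
- by rewrite big_seq1 big_nil /=; apply: (addrI (f 0 v)); rewrite -fDl !addr0.
- by rewrite big_seq1 big_cons big_seq1 /= fDl.
- by rewrite big_seq1 big_cons big_seq1 /= fDr.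
- by rewrite !big_seq1 /= fZ.
Qed.

Lemma tens_lift_pure u v : tens_lift (pure u v) = f u v.
Proof. by rewrite tens_lift_class big_seq1. Qed.

Lemma tens_liftD x y : tens_lift (x + y) = tens_lift x + tens_lift y.
Proof.
rewrite -(tens_reprK x) -(tens_reprK y) {1}/GRing.add /= tens_addE.
by rewrite !tens_lift_class big_cat.
Qed.

Lemma tens_lift0 : tens_lift 0 = 0.
Proof. by rewrite /GRing.zero /= tens_lift_class big_nil. Qed.

End Lift.

Lemma eq_tens_lift (P : zmodType) (f g : U -> V -> P) x :
  f =2 g -> tens_lift f x = tens_lift g x.
Proof. by move=> fg; apply: eq_bigr => p _. Qed.

Lemma tens_lift_addf (P : zmodType) (f g : U -> V -> P) x :
  tens_lift (fun u v => f u v + g u v) x = tens_lift f x + tens_lift g x.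
Proof. exact: big_split. Qed.

End TensorDef.

Arguments pure {k U V} u v.

Definition tensalg (k : fieldType) (B C : algType k) : Type := tens B C.

Section TensorAlgebra.
Variables (k : fieldType) (B C : algType k).
Local Notation T := (tensalg B C).

HB.instance Definition _ := GRing.Lmodule.copy T (tens B C).

Definition tensalg_one : T := pure (1 : B) (1 : C).
Definition tensalg_mul (x y : T) : T :=
  tens_lift (fun (b : B) (c : C) =>
    tens_lift (fun (b' : B) (c' : C) => pure (b * b') (c * c') : T) y) x.

Let mulr_balanced b c : balanced (fun (b' : B) (c' : C) =>
  pure (b * b') (c * c') : T).
Proof.
by split=> *; rewrite ?mulrDr ?pureDl ?pureDr // -!scalerAr pure_balanced.
Qed.

Let mull_balanced y : balanced (fun (b : B) (c : C) =>
  tens_lift (fun (b' : B) (c' : C) => pure (b * b') (c * c') : T) y).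
Proof.
split=> [u u' v|u v v'|a u v]; rewrite -?tens_lift_addf;
  apply: eq_tens_lift => b' c'; rewrite ?mulrDl ?pureDl ?pureDr //.
by rewrite -!scalerAl pure_balanced.
Qed.

Lemma tensalg_mul_pure b c b' c' :
  tensalg_mul (pure b c) (pure b' c') = pure (b * b') (c * c').
Proof. by rewrite /tensalg_mul !tens_lift_pure. Qed.

Lemma tensalg_mulDl : left_distributive tensalg_mul +%R.
Proof. by move=> x y z; apply: tens_liftD. Qed.

Lemma tensalg_mulDr : right_distributive tensalg_mul +%R.
Proof.
move=> x y z; rewrite /tensalg_mul -tens_lift_addf.
by apply: eq_tens_lift => b c; rewrite tens_liftD.
Qed.

Lemma tensalg_mul0l x : tensalg_mul 0 x = 0.
Proof. exact: tens_lift0. Qed.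

Lemma tensalg_mul0r x : tensalg_mul x 0 = 0.
Proof. by apply: (addrI (tensalg_mul x 0)); rewrite -tensalg_mulDr !addr0. Qed.

Lemma tensalg_mulA : associative tensalg_mul.
Proof.
move=> x y z; elim/tens_ind: x => [|b c|x x' hx hx'].
- by rewrite !tensalg_mul0l.
- elim/tens_ind: y => [|b' c'|y y' hy hy'].
  + by rewrite !(tensalg_mul0l, tensalg_mul0r).
  + elim/tens_ind: z => [|b'' c''|z z' hz hz'].
    * by rewrite !tensalg_mul0r.
    * by rewrite !tensalg_mul_pure !mulrA.
    * by rewrite !tensalg_mulDr hz hz'.
  + by rewrite !(tensalg_mulDl, tensalg_mulDr) hy hy'.
- by rewrite !tensalg_mulDl hx hx'.
Qed.

Lemma tensalg_mul1l : left_id tensalg_one tensalg_mul.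
Proof.
elim/tens_ind => [|b c|x y hx hy].
- exact: tensalg_mul0r.
- by rewrite tensalg_mul_pure !mul1r.
- by rewrite tensalg_mulDr hx hy.
Qed.

Lemma tensalg_mul1r : right_id tensalg_one tensalg_mul.
Proof.
elim/tens_ind => [|b c|x y hx hy].
- exact: tensalg_mul0l.
- by rewrite tensalg_mul_pure !mulr1.
- by rewrite tensalg_mulDl hx hy.
Qed.

HB.instance Definition _ := GRing.Zmodule_isPzRing.Build T
  tensalg_mulA tensalg_mul1l tensalg_mul1r tensalg_mulDl tensalg_mulDr.

End TensorAlgebra.

(* A B-module seen as a k-module through the structure map k -> B.  *)
Definition res_scalars (k : fieldType) (B : algType k) (M : lmodType B) : Type
  := M.

Section ResScalars.
Variables (k : fieldType) (B : algType k) (M : lmodType B).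
Local Notation T := (res_scalars M).
HB.instance Definition _ := GRing.Zmodule.copy T M.

Definition res_scale (a : k) (x : T) : T := (a%:A : B) *: (x : M).

Lemma res_scaleA a b x : res_scale a (res_scale b x) = res_scale (a * b) x.
Proof. by rewrite /res_scale scalerA -scalerAl mul1r scalerA. Qed.
Lemma res_scale1 : left_id 1 res_scale.
Proof. by move=> x; rewrite /res_scale !scale1r. Qed.
Lemma res_scaleDr : right_distributive res_scale +%R.
Proof. by move=> a x y; rewrite /res_scale scalerDr. Qed.
Lemma res_scaleDl x : {morph res_scale^~ x : a b / a + b}.
Proof. by move=> a b; rewrite /res_scale !scalerDl. Qed.

HB.instance Definition _ := GRing.Zmodule_isLmodule.Build k T
  res_scaleA res_scale1 res_scaleDr res_scaleDl.
End ResScalars.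

Definition tensmod (k : fieldType) (B C : algType k)
  (M : lmodType B) (N : lmodType C) : Type :=
  tens (res_scalars M) (res_scalars N).

Section TensorModule.
Variables (k : fieldType) (B C : algType k) (M : lmodType B) (N : lmodType C).
Local Notation T := (tensmod M N).
Local Notation A := (tensalg B C).
HB.instance Definition _ := GRing.Zmodule.copy T
  (tens (res_scalars M) (res_scalars N)).

Definition puremod (m : M) (n : N) : T :=
  pure (m : res_scalars M) (n : res_scalars N).

Definition tensmod_scale (t : A) (x : T) : T :=
  tens_lift (fun (b : B) (c : C) =>
    tens_lift (fun (m : res_scalars M) (n : res_scalars N) =>
      puremod (b *: (m : M)) (c *: (n : N))) x) t.

Lemma puremodDl m m' n : puremod (m + m') n = puremod m n + puremod m' n.
Proof. exact: pureDl. Qed.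
Lemma puremodDr m n n' : puremod m (n + n') = puremod m n + puremod m n'.
Proof. exact: pureDr. Qed.
Lemma puremod_balanced (a : k) m n :
  puremod ((a%:A : B) *: m) n = puremod m ((a%:A : C) *: n).
Proof. exact: pure_balanced. Qed.

Lemma scaleBAC (a : k) (b : B) (m : M) :
  b *: ((a%:A : B) *: m) = (a%:A : B) *: (b *: m).
Proof. by rewrite !scalerA -scalerAr -scalerAl mulr1 mul1r. Qed.

Lemma scaleCAC (a : k) (c : C) (n : N) :
  c *: ((a%:A : C) *: n) = (a%:A : C) *: (c *: n).
Proof. by rewrite !scalerA -scalerAr -scalerAl mulr1 mul1r. Qed.

Let scaler_balanced (b : B) (c : C) :
  balanced (fun (m : res_scalars M) (n : res_scalars N) =>
    puremod (b *: (m : M)) (c *: (n : N))).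
Proof.
split=> [u u' v|u v v'|a u v].
- by rewrite -puremodDl -scalerDr.
- by rewrite -puremodDr -scalerDr.
- by rewrite -[a *: u]/((a%:A : B) *: (u : M))
    -[a *: v]/((a%:A : C) *: (v : N)) scaleBAC scaleCAC puremod_balanced.
Qed.

Let scalel_balanced (x : T) : balanced (fun (b : B) (c : C) =>
    tens_lift (fun (m : res_scalars M) (n : res_scalars N) =>
      puremod (b *: (m : M)) (c *: (n : N))) x).
Proof.
split=> [u u' v|u v v'|a u v]; rewrite -?tens_lift_addf;
  apply: eq_tens_lift => m n; rewrite ?scalerDl ?puremodDl ?puremodDr //.
have -> : (a *: u) *: m = (a%:A : B) *: (u *: m).
  by rewrite scalerA -scalerAl mul1r.
by rewrite puremod_balanced scalerA -scalerAl mul1r.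
Qed.

Lemma tensmod_scale_pure b c m n :
  tensmod_scale (pure b c) (puremod m n) = puremod (b *: m) (c *: n).
Proof. by rewrite /tensmod_scale !tens_lift_pure. Qed.

Lemma tensmod_scaleDl (x : T) : {morph tensmod_scale^~ x : a b / a + b}.
Proof. by move=> a b; apply: tens_liftD. Qed.

Lemma tensmod_scaleDr : right_distributive tensmod_scale +%R.
Proof.
move=> t x y; rewrite /tensmod_scale -tens_lift_addf.
by apply: eq_tens_lift => b c; rewrite tens_liftD.
Qed.

Lemma tensmod_scale0l x : tensmod_scale 0 x = 0.
Proof. exact: tens_lift0. Qed.

Lemma tensmod_scale0r t : tensmod_scale t 0 = 0.
Proof.
by apply: (addrI (tensmod_scale t 0)); rewrite -tensmod_scaleDr !addr0.
Qed.

Lemma tensmod_scaleA t t' x :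
  tensmod_scale t (tensmod_scale t' x) = tensmod_scale (t * t') x.
Proof.
elim/tens_ind: t => [|b c|s s' hs hs'].
- by rewrite mul0r !tensmod_scale0l.
- elim/tens_ind: t' => [|b' c'|s s' hs hs'].
  + by rewrite mulr0 !(tensmod_scale0l, tensmod_scale0r).
  + elim/tens_ind: x => [|m n|x y hx hy].
    * by rewrite !tensmod_scale0r.
    * rewrite !tensmod_scale_pure [_ * _]tensalg_mul_pure tensmod_scale_pure.
      by rewrite !scalerA.
    * by rewrite !tensmod_scaleDr hx hy.
  + by rewrite mulrDr !tensmod_scaleDl tensmod_scaleDr hs hs'.
- by rewrite mulrDl !tensmod_scaleDl hs hs'.
Qed.

Lemma tensmod_scale1 : left_id 1 tensmod_scale.
Proof.
elim/tens_ind => [|m n|x y hx hy].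
- exact: tensmod_scale0r.
- by rewrite [tensmod_scale _ _]tensmod_scale_pure !scale1r.
- by rewrite tensmod_scaleDr hx hy.
Qed.

HB.instance Definition _ := GRing.Zmodule_isLmodule.Build A T
  tensmod_scaleA tensmod_scale1 tensmod_scaleDr tensmod_scaleDl.

Lemma scale_puremod b c m n :
  (pure b c : A) *: puremod m n = puremod (b *: m) (c *: n).
Proof. exact: tensmod_scale_pure. Qed.

Lemma tensmod_ind (P : T -> Prop) :
  P 0 -> (forall m n, P (puremod m n)) ->
  (forall x y, P x -> P y -> P (x + y)) -> forall x, P x.
Proof. exact: (@tens_ind k (res_scalars M) (res_scalars N)). Qed.

End TensorModule.

Section TensorMap.
Variables (k : fieldType) (B C : algType k).
Variables (M M' : lmodType B) (N N' : lmodType C).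
Variables (f : {linear M -> M'}) (g : {linear N -> N'}).

Definition tensmod_map (x : tensmod M N) : tensmod M' N' :=
  tens_lift (fun (m : res_scalars M) (n : res_scalars N) =>
    puremod (f m) (g n)) x.

Let map_balanced : balanced (fun (m : res_scalars M) (n : res_scalars N) =>
    puremod (f m) (g n)).
Proof.
split=> [u u' v|u v v'|a u v].
- by rewrite -puremodDl -raddfD.
- by rewrite -puremodDr -raddfD.
- by rewrite -[a *: u]/((a%:A : B) *: (u : M))
    -[a *: v]/((a%:A : C) *: (v : N)) !linearZ puremod_balanced.
Qed.

Lemma tensmod_map_pure m n :
  tensmod_map (puremod m n) = puremod (f m) (g n).
Proof. exact: tens_lift_pure. Qed.

Lemma tensmod_map_linear : linear tensmod_map.
Proof.
have map0 : tensmod_map 0 = 0 by apply: tens_lift0.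
have mapD x y : tensmod_map (x + y) = tensmod_map x + tensmod_map y.
  exact: tens_liftD.
move=> t x y; rewrite mapD; congr (_ + _).
elim/tens_ind: t => [|b c|s s' hs hs'].
- by rewrite !scale0r map0.
- elim/tensmod_ind: x => [|m n|x x' hx hx'].
  + by rewrite scaler0 map0 scaler0.
  + by rewrite scale_puremod !tensmod_map_pure scale_puremod !linearZ.
  + by rewrite scalerDr !mapD hx hx' scalerDr.
- by rewrite !scalerDl mapD hs hs'.
Qed.

HB.instance Definition _ := GRing.isLinear.Build (tensalg B C)
  (tensmod M N) (tensmod M' N') _ tensmod_map tensmod_map_linear.

End TensorMap.

Lemma tensmod_map_comp (k : fieldType) (B C : algType k)
    (M M' M'' : lmodType B) (N N' N'' : lmodType C)
    (f : {linear M -> M'}) (g : {linear N -> N'})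
    (f' : {linear M' -> M''}) (g' : {linear N' -> N''}) x :
  tensmod_map f' g' (tensmod_map f g x) = tensmod_map (f' \o f) (g' \o g) x.
Proof.
elim/tensmod_ind: x => [|m n|x y hx hy]; first by rewrite !raddf0.
- by rewrite !tensmod_map_pure.
- by rewrite !raddfD /= hx hy.
Qed.

Lemma eq_tensmod_map (k : fieldType) (B C : algType k)
    (M M' : lmodType B) (N N' : lmodType C)
    (f f' : {linear M -> M'}) (g g' : {linear N -> N'}) x :
  f =1 f' -> g =1 g' -> tensmod_map f g x = tensmod_map f' g' x.
Proof. by move=> ff gg; apply: eq_tens_lift => m n; rewrite ff gg. Qed.

Lemma tensmod_map0l (k : fieldType) (B C : algType k)
    (M M' : lmodType B) (N N' : lmodType C)
    (f : {linear M -> M'}) (g : {linear N -> N'}) x :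
  (forall m, f m = 0) -> tensmod_map f g x = 0.
Proof.
move=> f0; elim/tensmod_ind: x => [|m n|x y hx hy]; first exact: raddf0.
  by rewrite tensmod_map_pure f0; apply: (addrI (puremod 0 (g n)));
    rewrite -puremodDl !addr0.
by rewrite raddfD /= hx hy addr0.
Qed.

Lemma tensmod_map0r (k : fieldType) (B C : algType k)
    (M M' : lmodType B) (N N' : lmodType C)
    (f : {linear M -> M'}) (g : {linear N -> N'}) x :
  (forall n, g n = 0) -> tensmod_map f g x = 0.
Proof.
move=> g0; elim/tensmod_ind: x => [|m n|x y hx hy]; first exact: raddf0.
  by rewrite tensmod_map_pure g0; apply: (addrI (puremod (f m) 0));
    rewrite -puremodDr !addr0.
by rewrite raddfD /= hx hy addr0.
Qed.

(* Complexes in nonnegative degrees; [diff X n] is the differential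
   X_{n+1} -> X_n.  *)
Record complex (A : pzRingType) := Complex {
  obj :> nat -> lmodType A;
  diff : forall n, {linear obj n.+1 -> obj n};
  diff_diff : forall n x, diff n (diff n.+1 x) = 0
}.

Definition exact (A : pzRingType) (X : complex A) : Prop :=
  (forall y : X 0%N, exists x : X 1%N, diff X 0%N x = y) /\
  (forall n (y : X n.+1), diff X n y = 0 ->
     exists x : X n.+2, diff X n.+1 x = y).

(* The degree 0 condition is the one of degree n with h_{-1} = 0.  *)
Definition is_homotopy (A : pzRingType) (X : complex A)
    (h : forall n, {linear X n -> X n.+1}) : Prop :=
  (forall x : X 0%N, diff X 0%N (h 0%N x) = x) /\
  (forall n (x : X n.+1), diff X n.+1 (h n.+1 x) + h n (diff X n x) = x).

Definition admits_homotopy (A : pzRingType) (X : complex A) : Prop :=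
  exists h : forall n, {linear X n -> X n.+1}, is_homotopy h.

(* The index set {(n, m) | n + m = s} is finite, so that the direct sum is the
   module of families; [x n m e] is the component of x in M_n (x) N_m.  *)
Definition tot_obj (k : fieldType) (B C : algType k)
    (M : complex B) (N : complex C) (s : nat) : Type :=
  forall n m, (n + m)%N = s -> tensmod (M n) (N m).

Section Tot.
Variables (k : fieldType) (B C : algType k) (M : complex B) (N : complex C).
Local Notation A := (tensalg B C).

Lemma tot_ext s (x y : tot_obj M N s) :
  (forall n m e, x n m e = y n m e) -> x = y.
Proof.
by move=> h; do 3![apply: functional_extensionality_dep => ?]; apply: h.
Qed.

Section TotObj.
Variable s : nat.
Local Notation T := (tot_obj M N s).
HB.instance Definition _ := gen_eqMixin T.
HB.instance Definition _ := gen_choiceMixin T.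

Definition tot_zero : T := fun _ _ _ => 0.
Definition tot_add (x y : T) : T := fun n m e => x n m e + y n m e.
Definition tot_opp (x : T) : T := fun n m e => - x n m e.
Definition tot_scale (a : A) (x : T) : T := fun n m e => a *: x n m e.

Lemma tot_addA : associative tot_add.
Proof. by move=> x y z; apply: tot_ext => n m e; apply: addrA. Qed.
Lemma tot_addC : commutative tot_add.
Proof. by move=> x y; apply: tot_ext => n m e; apply: addrC. Qed.
Lemma tot_add0 : left_id tot_zero tot_add.
Proof. by move=> x; apply: tot_ext => n m e; apply: add0r. Qed.
Lemma tot_addN : left_inverse tot_zero tot_opp tot_add.
Proof. by move=> x; apply: tot_ext => n m e; apply: addNr. Qed.
HB.instance Definition _ :=
  GRing.isZmodule.Build T tot_addA tot_addC tot_add0 tot_addN.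

Lemma tot_scaleA a b x : tot_scale a (tot_scale b x) = tot_scale (a * b) x.
Proof. by apply: tot_ext => n m e; apply: scalerA. Qed.
Lemma tot_scale1 : left_id 1 tot_scale.
Proof. by move=> x; apply: tot_ext => n m e; apply: scale1r. Qed.
Lemma tot_scaleDr : right_distributive tot_scale +%R.
Proof. by move=> a x y; apply: tot_ext => n m e; apply: scalerDr. Qed.
Lemma tot_scaleDl x : {morph tot_scale^~ x : a b / a + b}.
Proof. by move=> a b; apply: tot_ext => n m e; apply: scalerDl. Qed.
HB.instance Definition _ := GRing.Zmodule_isLmodule.Build A T
  tot_scaleA tot_scale1 tot_scaleDr tot_scaleDl.
End TotObj.

Lemma succ_l n m s : (n + m)%N = s -> (n.+1 + m)%N = s.+1.
Proof. by move=> <-; rewrite addSn. Qed.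
Lemma succ_r n m s : (n + m)%N = s -> (n + m.+1)%N = s.+1.
Proof. by move=> <-; rewrite addnS. Qed.

(* The component in M_n (x) N_m of the differential of x receives the images of
   the components of x in M_{n+1} (x) N_m and in M_n (x) N_{m+1}.  *)
Definition tot_diff s (x : tot_obj M N s.+1) : tot_obj M N s :=
  fun n m e =>
    tensmod_map (diff M n) idfun (x n.+1 m (succ_l e))
    + (-1) ^+ n *: tensmod_map idfun (diff N m) (x n m.+1 (succ_r e)).

Lemma scale_signC (V : lmodType A) n (a : A) (x : V) :
  (-1) ^+ n *: (a *: x) = a *: ((-1) ^+ n *: x).
Proof. by rewrite !scalerA [a * _]commr_sign. Qed.

Lemma tot_diff_linear s : linear (@tot_diff s).
Proof.
move=> a x y; apply: tot_ext => n m e; rewrite /tot_diff.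
rewrite -[in RHS]/(a *: _ + _) !linearP !scalerDr scale_signC.
by rewrite addrACA.
Qed.

HB.instance Definition _ s := GRing.isLinear.Build A
  (tot_obj M N s.+1) (tot_obj M N s) _ (@tot_diff s) (@tot_diff_linear s).

Lemma tot_diff_diff s (x : tot_obj M N s.+2) : tot_diff (tot_diff x) = 0.
Proof.
apply: tot_ext => n m e; rewrite /tot_diff !raddfD /= !linearZ /=.
rewrite !tensmod_map_comp tensmod_map0l; last by move=> y; apply: diff_diff.
rewrite [X in _ + (_ + _ *: (_ *: X))]tensmod_map0r; last first.
  by move=> y; apply: diff_diff.
rewrite !scaler0 addr0 add0r exprS mulN1r scaleNr.
rewrite (eq_irrelevance (succ_l (succ_r e)) (succ_r (succ_l e))).
rewrite -[RHS](addNr ((-1) ^+ n *: tensmod_map (idfun \o diff M n)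
  (diff N m \o idfun) (x n.+1 m.+1 (succ_r (succ_l e))))).
congr (- (_ *: _) + _); exact: eq_tensmod_map.
Qed.

Definition Tot : complex A :=
  Complex (obj := fun s => tot_obj M N s) (diff := fun s => @tot_diff s)
    tot_diff_diff.

End Tot.

(* Main.v *)
From HB Require Import structures.
Require Import Defs.
From mathcomp Require Import all_boot all_algebra all_field.

Import GRing.Theory.
Local Open Scope ring_scope.

(** The maps [h_n ⊗ 1] form a
    homotopy of the total complex.  They carry no sign, so the cross terms
    [(-1)^(n+1) h_n ⊗ δ_m] and [(-1)^n h_n ⊗ δ_m] cancel, and what is left is
    [(d h + h d) ⊗ 1 = 1]. *)

(** The hypotheses are pointwise because the maps met below, such as [d h + h d], are identities
    only by the homotopy equations. *)
Lemma tensmod_map_id (k : fieldType) (B C : algType k)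
    (M : lmodType B) (N : lmodType C) (f : {linear M -> M})
    (g : {linear N -> N}) (x : tensmod M N) :
  f =1 id -> g =1 id -> tensmod_map f g x = x.
Proof.
move=> fid gid; elim/tensmod_ind: x => [|m n|x y hx hy].
- by rewrite raddf0.
- by rewrite tensmod_map_pure fid gid.
- by rewrite raddfD /= hx hy.
Qed.

(** Serves to merge [d h ⊗ 1] and [h d ⊗ 1] into a single map. *)
Lemma tensmod_map_addl (k : fieldType) (B C : algType k)
    (M M' : lmodType B) (N N' : lmodType C)
    (f f' : {linear M -> M'}) (g : {linear N -> N'}) (x : tensmod M N) :
  tensmod_map (f \+ f') g x = tensmod_map f g x + tensmod_map f' g x.
Proof.
elim/tensmod_ind: x => [|m n|x y hx hy].
- by rewrite !raddf0 addr0.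
- by rewrite !tensmod_map_pure puremodDl.
- by rewrite !raddfD /= hx hy addrACA.
Qed.

Section TotHomotopy.
Set Implicit Arguments.
Unset Strict Implicit.
Variables (k : fieldType) (B C : algType k) (M : complex B) (N : complex C).
Variable h : forall n, {linear M n -> M n.+1}.

(** Since [h] raises the first index, nothing lands in [M 0]: the value 0 there plays the role of
    [h_{-1} = 0]. *)
Definition tot_homotopy s (x : tot_obj M N s) : tot_obj M N s.+1 :=
  fun n m =>
    match n return (n + m)%N = s.+1 -> tensmod (M n) (N m) with
    | 0 => fun _ => 0
    | n'.+1 => fun e => tensmod_map (h n') idfun (x n' m (succn_inj e))
    end.

Lemma tot_homotopy_linear s : linear (@tot_homotopy s).
Proof.
move=> a x y; apply: tot_ext => [[|n]] m e /=.
- by rewrite -[RHS]/(a *: 0 + 0) scaler0 addr0.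
- exact: linearP.
Qed.

HB.instance Definition _ s := GRing.isLinear.Build (tensalg B C)
  (tot_obj M N s) (tot_obj M N s.+1) _ (@tot_homotopy s)
  (@tot_homotopy_linear s).

(** With [s] arbitrary, this covers total degree 0 as well as the row [n = 0] of every positive
    degree. *)
Lemma tot_diff_homotopy0 s (x : tot_obj M N s) m (e : (0 + m)%N = s) :
  (forall y : M 0%N, diff M 0 (h 0%N y) = y) ->
  tot_diff (tot_homotopy x) e = x 0%N m e.
Proof.
move=> dh; rewrite /tot_diff /= raddf0 scaler0 addr0 tensmod_map_comp.
rewrite (eq_irrelevance (succn_inj _) e); exact: tensmod_map_id.
Qed.

Lemma tot_diff_homotopyS s (x : tot_obj M N s.+1) n m
    (e : (n.+1 + m)%N = s.+1) :
  (forall y : M n.+1, diff M n.+1 (h n.+1 y) + h n (diff M n y) = y) ->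
  tot_diff (tot_homotopy x) e + tot_homotopy (tot_diff x) e
    = x n.+1 m e.
Proof.
move=> dh; rewrite /tot_diff /= !raddfD /= linearZ /= !tensmod_map_comp.
(* The two orders of composition reach the same component of [x] through different proofs of its
   index equation, which must be identified. *)
rewrite (eq_irrelevance (succn_inj (succ_r e)) (succ_r (succn_inj e))).
rewrite (eq_irrelevance (succn_inj (succ_l e)) e).
rewrite (eq_irrelevance (succ_l (succn_inj e)) e).
set z := x n m.+1 _; set w := x n.+1 m e.
(* [h] and [δ] act on different factors, so both cross terms are the same map applied to [z]. *)
rewrite (@eq_tensmod_map _ _ _ _ _ _ _ (idfun \o h n) (h n \o idfun)
  (diff N m \o idfun) (idfun \o diff N m) z) //.
rewrite exprS mulN1r scaleNr addrACA addNr addr0 -tensmod_map_addl.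
exact: tensmod_map_id.
Qed.

End TotHomotopy.

Theorem lemma4p3 (k : fieldType) (B C : falgType k)
  (M : complex B) (N : complex C)
  (h : forall n, {linear M n -> M n.+1})
  (eta : forall n, {linear N n -> N n.+1}) :
  perfect_field k ->
  2%N \notin [pchar k] ->
  (forall n, fin_gen (M n)) ->
  (forall n, fin_gen (N n)) ->
  exact M ->
  exact N ->
  is_homotopy h ->
  is_homotopy eta ->
  admits_homotopy (Tot M N).
Proof.
move=> _ _ _ _ _ _ [dh0 dhS] _.
exists (fun s => @tot_homotopy k B C M N h s); split=> [x|s x];
  apply: tot_ext => [[|n] m e].
- exact: tot_diff_homotopy0.
(* The index equation [n.+1 + m = 0] is absurd. *)
- by [].
(* The [h d] summand is 0 by computation in the row [n = 0]. *)
- rewrite -[RHS](tot_diff_homotopy0 x e dh0); exact: addr0.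
- exact: tot_diff_homotopyS.
Qed.
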